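(* Let $G$ be a finite simple connected graph with $\omega(G)\ge 2$ that contains no induced subgraph isomorphic to $P_5$ or to $K_1+2K_2$. Then $\chi(G)\le \frac{3}{2}\left(\omega^2(G)-\omega(G)\right)$.
   Context: $P_5$ is the path on 5 vertices, $K_t$ the complete graph on $t$ vertices. For disjoint graphs $F_1,F_2$, $F_1\cup F_2$ is their disjoint union, $kF$ is the disjoint union of $k$ copies of $F$, and $F_1+F_2$ is the join (disjoint union plus all edges between $V(F_1)$ and $V(F_2)$). Thus $K_1+2K_2$ is a vertex adjacent to all four vertices of two disjoint edges. $\chi$ is the chromatic number and $\omega$ the clique number. *)

(* Defs.v *)
From HB Require Import structures.
From mathcomp Require Import all_boot all_order all_algebra.

Set Implicit Arguments.
Unset Strict Implicit.
Unset Printing Implicit Defensive.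

Record sgraph := SGraph {
  vertex :> finType;
  adj : rel vertex;
  adj_sym : symmetric adj;
  adj_irr : irreflexive adj
}.
Arguments adj {s} : rename.

Section Path.
Variable n : nat.
Definition path_adj : rel 'I_n :=
  fun i j => (i.+1 == j :> nat) || (j.+1 == i :> nat).
Fact path_adj_sym : symmetric path_adj.
Proof. by move=> i j; rewrite /path_adj orbC. Qed.
Fact path_adj_irr : irreflexive path_adj.
Proof. by move=> i; rewrite /path_adj orbb; apply/eqP/nesym/n_Sn. Qed.
(* The path on n vertices (not n edges). *)
Definition path_graph : sgraph := SGraph path_adj_sym path_adj_irr.
End Path.

Section Complete.
Variable n : nat.
Definition complete_adj : rel 'I_n := fun i j => i != j.
Fact complete_adj_sym : symmetric complete_adj.
Proof. by move=> i j; rewrite /complete_adj eq_sym. Qed.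
Fact complete_adj_irr : irreflexive complete_adj.
Proof. by move=> i; rewrite /complete_adj eqxx. Qed.
Definition complete_graph : sgraph := SGraph complete_adj_sym complete_adj_irr.
End Complete.

Section Join.
Variables F1 F2 : sgraph.
Definition join_adj : rel (F1 + F2)%type := fun u v =>
  match u, v with
  | inl x, inl y => adj x y
  | inr x, inr y => adj x y
  | _, _ => true
  end.
Fact join_adj_sym : symmetric join_adj.
Proof. by move=> [x|x] [y|y] //=; rewrite adj_sym. Qed.
Fact join_adj_irr : irreflexive join_adj.
Proof. by move=> [x|x] /=; rewrite adj_irr. Qed.
Definition join_graph : sgraph := SGraph join_adj_sym join_adj_irr.
End Join.

Section Copies.
Variables (k : nat) (F : sgraph).
Definition copies_adj : rel ('I_k * F)%type :=
  fun u v => (u.1 == v.1) && adj u.2 v.2.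
Fact copies_adj_sym : symmetric copies_adj.
Proof. by move=> u v; rewrite /copies_adj eq_sym adj_sym. Qed.
Fact copies_adj_irr : irreflexive copies_adj.
Proof. by move=> u; rewrite /copies_adj adj_irr andbF. Qed.
(* The disjoint union kF; the first component names the copy. *)
Definition copies_graph : sgraph := SGraph copies_adj_sym copies_adj_irr.
End Copies.

Section Induced.
Variables (G : sgraph) (A : {set G}).
Definition induced_adj : rel {x : G | x \in A} := fun u v => adj (val u) (val v).
Fact induced_adj_sym : symmetric induced_adj.
Proof. by move=> u v; apply: adj_sym. Qed.
Fact induced_adj_irr : irreflexive induced_adj.
Proof. by move=> u; apply: adj_irr. Qed.
Definition induced : sgraph := SGraph induced_adj_sym induced_adj_irr.
End Induced.

Definition isomorphic (G H : sgraph) : Prop :=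
  exists2 f : G -> H, bijective f & {mono f : x y / adj x y}.

Definition induced_free (G H : sgraph) : Prop :=
  ~ exists A : {set G}, isomorphic (induced A) H.

Definition connected (G : sgraph) : Prop := forall x y : G, connect adj x y.

Definition clique (G : sgraph) (A : {set G}) : bool :=
  [forall x in A, forall y in A, (x != y) ==> adj x y].

Definition clique_number (G : sgraph) : nat := \max_(A : {set G} | clique A) #|A|.

Definition colorable (G : sgraph) (k : nat) : bool :=
  [exists c : {ffun G -> 'I_k}, forall x, forall y, adj x y ==> (c x != c y)].

Fact colorable_exists (G : sgraph) : exists k, colorable G k.
Proof.
exists #|G|; apply/existsP; exists [ffun x => enum_rank x].
apply/forallP=> x; apply/forallP=> y; apply/implyP=> xy; rewrite !ffunE.
by apply: contraTneq xy => /enum_rank_inj ->; rewrite adj_irr.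
Qed.

Definition chromatic_number (G : sgraph) : nat := ex_minn (colorable_exists G).

(* Main.v *)
(** Minimum connected dominating sets, in the manner of Camby and Schaudt, give
    Bacsó and Tuza's theorem that a connected [P_5]-free graph has a dominating
    clique or a dominating induced path on three vertices.  In such a set [D] a
    vertex [x] whose removal keeps [D] connected has a private neighbour [p].
    Private neighbours of nonadjacent vertices [x] and [y] are adjacent, since
    they would otherwise extend a path [x - m - y] to an induced [P_5]; hence
    [y] can be exchanged for [p].  Two exchanges turn a nonclique [D] into a
    path.

    Since [G] has no [K_1 + 2K_2], neighbourhoods are [2K_2]-free with clique
    number less than [omega], hence ['C(omega, 2)]-colourable (Wagon).  The
    neighbourhoods of a dominating path cover [G].  For a dominating clique, two
    neighbourhoods leave at most [omega - 2] stable sets uncovered.  In both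
    cases [3 * 'C(omega, 2)] colours suffice. *)

Require Import Defs.
From mathcomp Require Import all_boot all_order all_algebra.
From mathcomp Require Import zify ring.

Set Implicit Arguments.
Unset Strict Implicit.
Unset Printing Implicit Defensive.

(** * Forbidden induced subgraphs *)

(* A map that preserves and reflects adjacency is injective on a graph without
   twins, so only adjacencies need checking to exhibit an induced copy. *)
Definition twin_free (H : sgraph) := forall x y : H, adj x =1 adj y -> x = y.

Lemma path_graph_twin_free n : 3 < n -> twin_free (path_graph n).
Proof.
move=> n_gt3; have twins_leq (x y : path_graph n) : adj x =1 adj y -> y <= x.
  move=> xy; rewrite leqNgt; apply/negP=> x_lt_y.
  have adj_xy k : k < n ->
      (x.+1 == k) || (k.+1 == x) = (y.+1 == k) || (k.+1 == y).
    by move=> k_lt; apply: (xy (Ordinal k_lt)).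
  have [x0|x_gt0] := posnP x; last first.
    have := adj_xy x.-1 (leq_ltn_trans (leq_pred x) (ltn_ord x)).
    by rewrite prednK // eqxx orbT; lia.
  have y2 : y = 2 :> nat.
    by have := adj_xy 1 (ltn_trans _ n_gt3); rewrite x0 /=; lia.
  by have := adj_xy 3 n_gt3; rewrite x0 y2.
by move=> x y xy; apply/val_inj/eqP; rewrite eqn_leq !twins_leq.
Qed.

Lemma complete_graph_twin_free n : twin_free (complete_graph n).
Proof. by move=> x y /(_ y) /=; rewrite /complete_adj eqxx => /negbFE/eqP. Qed.

Lemma copies_graph_twin_free k (F : sgraph) :
  (forall x : F, exists y, adj x y) -> twin_free F ->
  twin_free (copies_graph k F).
Proof.
move=> no_isolated F_twin_free [i x] [j y] xy.
have eq_ij : i = j.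
  have [z xz] := no_isolated x.
  by have := xy (i, z); rewrite /= /copies_adj /= eqxx xz => /esym/andP[/eqP].
rewrite -eq_ij; congr pair; apply: F_twin_free => z.
by have := xy (i, z); rewrite /= /copies_adj /= -eq_ij eqxx.
Qed.

Lemma join_graph_twin_free (F1 F2 : sgraph) :
  twin_free F1 -> twin_free F2 -> twin_free (join_graph F1 F2).
Proof.
move=> F1_twin_free F2_twin_free [x|x] [y|y] xy.
- by congr inl; apply: F1_twin_free => z; apply: (xy (inl z)).
- by have := xy (inl x); rewrite /= adj_irr.
- by have := xy (inr x); rewrite /= adj_irr.
- by congr inr; apply: F2_twin_free => z; apply: (xy (inr z)).
Qed.

Lemma induced_free_mono (G H : sgraph) (g : H -> G) :
  induced_free G H -> twin_free H -> ~ {mono g : x y / adj x y}.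
Proof.
move=> H_free H_twin_free g_mono; apply: H_free; exists (g @: [set: H]).
have g_inj : injective g.
  by move=> x y gxy; apply: H_twin_free => z; rewrite -!g_mono gxy.
pose h x : induced (g @: [set: H]) := exist _ (g x) (imset_f g (in_setT x)).
have h_inj : injective h by move=> x y /(congr1 val) /g_inj.
have [k hk kh] : bijective h.
  by apply: inj_card_bij => //=; rewrite card_sig card_imset // cardsT.
exists k; first by exists h.
by move=> x y; rewrite -{2}[x]kh -{2}[y]kh /= /induced_adj /= g_mono.
Qed.

Section InducedPatterns.
Variable G : sgraph.
Implicit Types (a b c d e v : G) (S : {set G}).

Definition nbhd v := [set x | adj v x].

Definition induced_P3 a b c := [&& adj a b, adj b c & ~~ adj a c].

Definition induced_P5 a b c d e :=
  [&& adj a b, adj b c, adj c d, adj d e, ~~ adj a c, ~~ adj a d, ~~ adj a e,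
      ~~ adj b d, ~~ adj b e & ~~ adj c e].

Definition induced_2K2 a b c d :=
  [&& adj a b, adj c d, ~~ adj a c, ~~ adj a d, ~~ adj b c & ~~ adj b d].

Definition twoK2_free S :=
  forall a b c d, a \in S -> b \in S -> c \in S -> d \in S ->
    ~~ induced_2K2 a b c d.

Lemma not_induced_P5 a b c d e :
  induced_free G (path_graph 5) -> ~~ induced_P5 a b c d e.
Proof.
move=> P5_free; apply/negP.
case/and5P=> ab bc cd de /and5P[/negbTE ac /negbTE ad /negbTE ae /negbTE bd].
case/andP=> /negbTE be /negbTE ce.
pose g (i : path_graph 5) := nth a [:: a; b; c; d; e] i.
apply: (@induced_free_mono _ _ g P5_free); first exact: path_graph_twin_free.
move=> [[|[|[|[|[|//]]]]] ?] [[|[|[|[|[|//]]]]] ?];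
by rewrite /g /= /path_adj /= ?adj_irr // adj_sym.
Qed.

Lemma nbhd_twoK2_free v :
  induced_free G (join_graph (complete_graph 1)
                             (copies_graph 2 (complete_graph 2))) ->
  twoK2_free (nbhd v).
Proof.
set H := join_graph _ _ => H_free a b c d; rewrite !inE => va vb vc vd.
apply/negP; case/and5P=> ab cd /negbTE ac /negbTE ad.
case/andP=> /negbTE bc /negbTE bd.
pose g (u : H) :=
  match u with inl _ => v | inr (i, j) => nth v [:: a; b; c; d] (i.*2 + j) end.
apply: (@induced_free_mono _ _ g H_free).
  apply: join_graph_twin_free; first exact: complete_graph_twin_free.
  apply: copies_graph_twin_free (@complete_graph_twin_free 2).
  by move=> x; exists (rev_ord x); case: x => [[|[|//]] ?].
move=> [[[|//] ?]|[[[|[|//]] ?] [[|[|//]] ?]]]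
       [[[|//] ?]|[[[|[|//]] ?] [[|[|//]] ?]]];
rewrite /g /= /complete_adj /copies_adj /= ?adj_irr ?ab ?cd // 1?adj_sym;
by rewrite ?adj_irr ?ab ?cd.
Qed.

End InducedPatterns.

(** * Connected dominating sets *)

Section Domination.
Variable G : sgraph.
Implicit Types (A B D : {set G}) (x y z p q r v : G).

Lemma adj_neq x y : adj x y -> x != y.
Proof. by apply: contraTneq => ->; rewrite adj_irr. Qed.

Lemma cliqueP A : reflect {in A &, forall x y, x != y -> adj x y} (clique A).
Proof.
apply: (iffP forall_inP) => [A_clique x y xA yA | A_clique x xA].
  by move: (A_clique x xA) => /forall_inP/(_ y yA)/implyP.
by apply/forall_inP=> y yA; apply/implyP; apply: A_clique.
Qed.

Lemma cliquePn A :
  reflect (exists x y, [/\ x \in A, y \in A, x != y & ~~ adj x y])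
          (~~ clique A).
Proof.
apply: (iffP idP) => [|[x [y [xA yA xy]]]]; last first.
  by apply: contraNN => /cliqueP; apply.
rewrite negb_forall_in => /exists_inP[x xA]; rewrite negb_forall_in.
by case/exists_inP=> y yA; rewrite negb_imply => /andP[xy nxy]; exists x, y.
Qed.

Definition nbhds D := \bigcup_(d in D) nbhd d.

Definition closed_nbhd D := D :|: nbhds D.

Definition dominating D := closed_nbhd D == setT.

Lemma nbhdsP D v : reflect (exists2 d, d \in D & adj d v) (v \in nbhds D).
Proof.
by apply: (iffP bigcupP) => -[d dD dv]; exists d; rewrite ?inE in dv *.
Qed.

Lemma sub_closed_nbhd D : D \subset closed_nbhd D.
Proof. exact: subsetUl. Qed.

Lemma adj_closed_nbhd D d v : d \in D -> adj d v -> v \in closed_nbhd D.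
Proof.
by move=> dD dv; rewrite inE; apply/orP; right; apply/nbhdsP; exists d.
Qed.

Lemma closed_nbhdS A B : A \subset B -> closed_nbhd A \subset closed_nbhd B.
Proof.
move=> AB; apply: setUSS (AB) _; apply/subsetP=> v /nbhdsP[d dA dv].
by apply/nbhdsP; exists d; first exact: (subsetP AB).
Qed.

Lemma dominatingS A B : A \subset B -> dominating A -> dominating B.
Proof.
move=> AB /eqP A_dom; rewrite /dominating -subTset -A_dom; exact: closed_nbhdS.
Qed.

(* Connectivity is stated through cuts, which avoids paths altogether. *)
Definition connected_set D :=
  [forall A : {set G}, (A != set0) && (A \proper D) ==>
     [exists x in A, exists y in D :\: A, adj x y]].

Lemma connected_setP D :
  reflect (forall A, A != set0 -> A \proper D ->
             exists x y, [/\ x \in A, y \in D, y \notin A & adj x y])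
          (connected_set D).
Proof.
apply: (iffP forallP) => D_conn A.
  move=> A0 AD; have := D_conn A; rewrite A0 AD /=.
  case/exists_inP=> x xA /exists_inP[y]; rewrite inE => /andP[yA yD] xy.
  by exists x, y.
apply/implyP=> /andP[A0 AD]; have [x [y [xA yD yA xy]]] := D_conn A A0 AD.
apply/exists_inP; exists x => //.
by apply/exists_inP; exists y; rewrite ?inE ?yA.
Qed.

Lemma connected_setT : connected G -> connected_set [set: G].
Proof.
move=> G_conn; apply/forallP=> A; apply/implyP=> /andP[/set0Pn[a aA]].
rewrite properT; apply: contraNT => no_edge; rewrite eqEsubset subsetT /=.
have A_closed : closed adj A.
  apply: intro_closed => [|x y xy xA]; first exact/sym_connect_sym/adj_sym.
  apply: contraNT no_edge => yA; apply/exists_inP; exists x => //.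
  by apply/exists_inP; exists y; rewrite // !inE yA.
by apply/subsetP=> b _; rewrite -(closed_connect A_closed (G_conn a b)).
Qed.

Lemma connected_setU1 A x y :
  connected_set A -> x \in A -> adj x y -> connected_set (y |: A).
Proof.
move=> /connected_setP A_conn xA xy; apply/connected_setP=> B /set0Pn[b bB].
case/properP=> /subsetP ByA [c cyA cB].
have [xB|xB] := boolP (x \in B); have [yB|yB] := boolP (y \in B).
- have [||u [v [/setIP[_ uB] vA vAB uv]]] := A_conn (A :&: B).
  + by apply/set0Pn; exists x; rewrite inE xA.
  + apply/properP; split; first exact: subsetIl.
    case/setU1P: cyA => [cy|cA]; first by rewrite cy yB in cB.
    by exists c; rewrite // inE cA.
  by exists u, v; rewrite inE vA orbT; split=> //; rewrite inE vA in vAB.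
- by exists x, y; rewrite setU11.
- by exists y, x; rewrite inE xA orbT adj_sym.
- have BA z : z \in B -> z \in A.
    by move=> zB; case/setU1P: (ByA z zB) => // zy; rewrite -zy zB in yB.
  have [||u [v [uB vA vB uv]]] := A_conn B.
  + by apply/set0Pn; exists b.
  + by apply/properP; split; [apply/subsetP | exists x].
  by exists u, v; rewrite inE vA orbT.
Qed.

Lemma connected_set_star D r : r \in D -> connected_set (r |: D :&: nbhd r).
Proof.
move=> rD; apply/connected_setP=> A /set0Pn[a aA].
case/properP=> /subsetP Astar [b bstar bA].
have [rA|rA] := boolP (r \in A).
  exists r, b; split=> //; case/setU1P: bstar => [br|].
    by rewrite br rA in bA.
  by rewrite !inE => /andP[].
exists a, r; rewrite setU11; split=> //; case/setU1P: (Astar a aA) => [ar|].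
  by rewrite -ar aA in rA.
by rewrite !inE adj_sym => /andP[].
Qed.

Lemma ex_noncut_vertex D A :
  connected_set D -> connected_set A -> A != set0 -> A \proper D ->
  exists u, [/\ u \in D, u \notin A & connected_set (D :\ u)].
Proof.
move=> D_conn A_conn A0 AD.
pose P B := [&& connected_set B, B != set0 & B \proper D].
have [|B /maxsetP[/and3P[B_conn B0 BD] B_max] AB] := @maxset_exists _ P A.
  by rewrite /P A_conn A0.
have [x [u [xB uD uB xu]]] := connected_setP _ D_conn _ B0 BD.
have uB_eqD : u |: B = D.
  apply: contraNeq uB => uB_neqD.
  rewrite -(B_max (u |: B)) ?setU11 ?subsetUr //.
  rewrite /P (connected_setU1 B_conn xB xu) properEneq uB_neqD.
  rewrite subUset sub1set uD proper_sub // !andbT.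
  by apply/set0Pn; exists u; apply: setU11.
exists u; split=> //; first by apply: contraNN uB; apply: (subsetP AB).
by rewrite -uB_eqD setU1K.
Qed.

Lemma ex_nonadj_noncut_vertex D r z :
  connected_set D -> r \in D -> z \in D -> r != z -> ~~ adj r z ->
  exists u, [/\ u \in D, r != u, ~~ adj r u & connected_set (D :\ u)].
Proof.
move=> D_conn rD zD rz nrz.
have [||u [uD]] := ex_noncut_vertex D_conn (connected_set_star rD).
- by apply/set0Pn; exists r; apply: setU11.
- apply/properP; split; first by rewrite subUset sub1set rD subsetIl.
  by exists z => //; rewrite !inE negb_or zD eq_sym rz.
by rewrite !inE uD negb_or eq_sym => /andP[ru nru] Du_conn; exists u.
Qed.

Definition min_connected_dominating D :=
  [/\ connected_set D, dominating D &
      forall A, connected_set A -> dominating A -> #|D| <= #|A|].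

Lemma ex_min_connected_dominating :
  connected G -> exists D, min_connected_dominating D.
Proof.
move=> /connected_setT T_conn; pose P D := connected_set D && dominating D.
have PT : P setT.
  by rewrite /P T_conn /dominating -subTset; apply: sub_closed_nbhd.
case: (arg_minnP (fun D : {set G} => #|D|) PT) => D /andP[D_conn D_dom] D_min.
by exists D; split=> // A A_conn A_dom; apply: D_min; rewrite /P A_conn.
Qed.

Definition private_nbr D x p := adj x p && (p \notin closed_nbhd (D :\ x)).

Lemma private_nbr_adj D x p : private_nbr D x p -> adj x p.
Proof. by case/andP. Qed.

Lemma private_nbr_notin D x p : private_nbr D x p -> p \notin D.
Proof.
case/andP=> xp; apply: contraNN => pD; apply: (subsetP (sub_closed_nbhd _)).
by rewrite !inE pD andbT; apply: contraTneq xp => ->; rewrite adj_irr.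
Qed.

Lemma private_nbr_nonadj D x p d :
  private_nbr D x p -> d \in D -> d != x -> ~~ adj p d.
Proof.
case/andP=> _ p_priv dD dx; apply: contraNN p_priv; rewrite adj_sym.
by apply: adj_closed_nbhd; rewrite !inE dx.
Qed.

Lemma private_nbr_swapK D x y p :
  private_nbr D x p -> (p |: D :\ y) :\ p = D :\ y.
Proof.
by move/private_nbr_notin=> pD; rewrite setU1K // !inE (negPf pD) andbF.
Qed.

Lemma private_nbr_pendant D x y p d :
  private_nbr D x p -> d \in p |: D :\ y -> adj p d -> d = x.
Proof.
move=> xp; rewrite !inE => /predU1P[->|/andP[_ dD]]; first by rewrite adj_irr.
by apply: contraTeq; apply: private_nbr_nonadj xp dD.
Qed.

Lemma undominated_private_nbr D x v :
  connected_set D -> dominating D -> x \in D -> D :\ x != set0 ->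
  v \notin closed_nbhd (D :\ x) -> private_nbr D x v.
Proof.
move=> /connected_setP D_conn /eqP D_dom xD /set0Pn[z zDx] v_undom.
rewrite /private_nbr v_undom andbT.
have: v \in closed_nbhd D by rewrite D_dom.
have adj_undom d : d \in D -> adj d v -> d = x.
  move=> dD dv; apply: contraNeq v_undom => dx.
  by apply: adj_closed_nbhd dv; rewrite !inE dx.
rewrite inE => /orP[vD|/nbhdsP[d dD dv]]; last by rewrite -(adj_undom d).
have vx : v = x.
  apply: contraNeq v_undom => vx; apply: (subsetP (sub_closed_nbhd _)).
  by rewrite !inE vx.
move: zDx; rewrite !inE => /andP[zx zD].
have [||u [d [/set1P-> dD]]] := D_conn [set x].
- by apply/set0Pn; exists x; apply: set11.
- by apply/properP; split; [rewrite sub1set | exists z; rewrite ?inE].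
by rewrite inE -vx adj_sym => dx dv; rewrite (adj_undom d) // vx eqxx in dx.
Qed.

Lemma ex_private_nbr D x :
  min_connected_dominating D -> x \in D -> D :\ x != set0 ->
  connected_set (D :\ x) -> exists p, private_nbr D x p.
Proof.
move=> [D_conn D_dom D_min] xD Dx0 Dx_conn.
have : ~~ dominating (D :\ x).
  by apply/negP=> /(D_min _ Dx_conn); rewrite (cardsD1 x D) xD ltnn.
rewrite /dominating -subTset => /subsetPn[v _ v_undom].
by exists v; apply: undominated_private_nbr.
Qed.

Lemma ex_private_nbr_nonclique D :
  min_connected_dominating D -> ~~ clique D ->
  exists x z p, [/\ x \in D, z \in D, x != z, ~~ adj x z & private_nbr D x p].
Proof.
move=> D_min /cliquePn[z [y [zD yD zy nzy]]]; have [D_conn _ _] := D_min.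
have [x [xD zx nzx Dx_conn]] := ex_nonadj_noncut_vertex D_conn zD yD zy nzy.
have [|p xp] := ex_private_nbr D_min xD _ Dx_conn.
  by apply/set0Pn; exists z; rewrite !inE zx.
by exists x, z, p; rewrite eq_sym adj_sym.
Qed.

Section P5Free.
Hypothesis P5_free : induced_free G (path_graph 5).

Lemma private_nbr_radius2 D x p y :
  connected_set D -> x \in D -> private_nbr D x p -> y \in D ->
  x != y -> ~~ adj x y -> exists m, [/\ m \in D, adj x m & adj m y].
Proof.
move=> /connected_setP D_conn xD xp yD xy nxy.
pose ball2 := [set v in D |
  [|| v == x, adj x v | [exists m in D, adj x m && adj m v]]].
have : y \in ball2.
  apply/negPn/negP=> y_far; have [||b [z [b_near zD z_far bz]]] := D_conn ball2.
  - by apply/set0Pn; exists x; rewrite inE xD eqxx.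
  - apply/properP; split; last by exists y.
    by apply/subsetP=> v; rewrite inE => /andP[].
  move: b_near z_far; rewrite !inE zD /= => /andP[bD b_near].
  rewrite !negb_or => /and3P[zx nxz no_mid].
  have no_edge m : m \in D -> adj x m -> ~~ adj m z.
    move=> mD xm; apply: contraNN no_mid => mz.
    by apply/exists_inP; exists m; rewrite ?xm.
  have nxb : ~~ adj x b by apply: contraTN bz; apply: no_edge.
  have bx : b != x by apply: contraTneq bz => ->.
  rewrite (negPf bx) (negPf nxb) in b_near.
  have /exists_inP[m mD /andP[xm mb]] := b_near.
  have mx : m != x by rewrite eq_sym adj_neq.
  have /negP[] := not_induced_P5 p x m b z P5_free.
  have p_nonadj := private_nbr_nonadj xp.
  rewrite /induced_P5 adj_sym (private_nbr_adj xp) xm mb bz.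
  by rewrite !p_nonadj ?nxb ?nxz ?no_edge.
rewrite inE yD eq_sym (negPf xy) (negPf nxy) => /exists_inP[m mD /andP[xm my]].
by exists m.
Qed.

Lemma private_nbrs_adj D x y p q :
  connected_set D -> x \in D -> y \in D -> x != y -> ~~ adj x y ->
  private_nbr D x p -> private_nbr D y q -> adj p q.
Proof.
move=> D_conn xD yD xy nxy xp yq; apply: contraT => npq.
have [m [mD xm my]] := private_nbr_radius2 D_conn xD xp yD xy nxy.
have mx : m != x by rewrite eq_sym adj_neq.
have /negP[] := not_induced_P5 p x m y q P5_free.
have p_nonadj := private_nbr_nonadj xp; have q_nonadj := private_nbr_nonadj yq.
rewrite /induced_P5 (adj_sym p x) (private_nbr_adj xp) xm my.
rewrite (private_nbr_adj yq) nxy npq (adj_sym x q) (adj_sym m q).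
by rewrite !p_nonadj ?q_nonadj ?(adj_neq my) // eq_sym.
Qed.

Lemma min_connected_dominating_swap D x y p :
  min_connected_dominating D -> x \in D -> y \in D -> x != y -> ~~ adj x y ->
  connected_set (D :\ y) -> private_nbr D x p ->
  min_connected_dominating (p |: D :\ y).
Proof.
move=> [D_conn D_dom D_min] xD yD xy nxy Dy_conn xp.
have xDy : x \in D :\ y by rewrite !inE xy.
split; first exact: connected_setU1 (private_nbr_adj xp).
- rewrite /dominating -subTset; apply/subsetP=> v _.
  have [v_dom|v_undom] := boolP (v \in closed_nbhd (D :\ y)).
    by apply: (subsetP (closed_nbhdS _)) v_dom; apply: subsetUr.
  have yv : private_nbr D y v.
    by apply: undominated_private_nbr => //; apply/set0Pn; exists x.
  apply: adj_closed_nbhd (setU11 _ _) _.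
  exact: private_nbrs_adj D_conn xD yD xy nxy xp yv.
- move=> A A_conn A_dom; apply: leq_trans (D_min A A_conn A_dom).
  by rewrite cardsU1 (cardsD1 y D) yD leq_add2r; case: (_ \notin _).
Qed.

Lemma min_connected_dominating_exchange D x z p :
  min_connected_dominating D -> x \in D -> z \in D -> x != z -> ~~ adj x z ->
  private_nbr D x p ->
  exists y q, [/\ y \in D, x != y, ~~ adj x y,
                 min_connected_dominating (p |: D :\ y) &
                 private_nbr (p |: D :\ y) p q].
Proof.
move=> D_min xD zD xz nxz xp; have [D_conn _ _] := D_min.
have [y [yD xy nxy Dy_conn]] := ex_nonadj_noncut_vertex D_conn xD zD xz nxz.
have E_min := min_connected_dominating_swap D_min xD yD xy nxy Dy_conn xp.
have Ep := private_nbr_swapK y xp.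
have [||q pq] := ex_private_nbr E_min (setU11 _ _); rewrite ?Ep //.
  by apply/set0Pn; exists x; rewrite !inE xy.
by exists y, q.
Qed.

Lemma subset_pendant_P3 D q p x t :
  connected_set D -> q \in D -> private_nbr D q t ->
  {in D, forall v, adj q v -> v = p} ->
  {in D :\ q, forall v, adj p v -> v = x} ->
  D \subset [set q; p; x].
Proof.
move=> D_conn qD qt q_pendant p_pendant; apply/subsetP=> v vD; rewrite !inE.
have [//|qv] := eqVneq v q; have [//|pv] := eqVneq v p; rewrite eq_sym in qv.
have nqv : ~~ adj q v by apply: contraNN pv => /(q_pendant v vD)->.
have [m [mD qm mv]] := private_nbr_radius2 D_conn qD qt vD qv nqv.
rewrite (q_pendant m) // in mv.
by rewrite (p_pendant v) ?eqxx // !inE eq_sym qv.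
Qed.

(* The exchange turns [x] into the only neighbour of its private neighbour [p].
   A second exchange at [p] makes [q - p - x] the end of a pendant path, where
   [private_nbr_radius2] at [q] leaves no room for a fourth vertex. *)
Theorem P5_free_dominating_clique_or_P3 : connected G ->
  (exists2 K, clique K & dominating K) \/
  (exists q p x, induced_P3 q p x /\ dominating [set q; p; x]).
Proof.
move=> /ex_min_connected_dominating[D D_min]; have [D_conn D_dom _] := D_min.
have [D_clique|/(ex_private_nbr_nonclique D_min)] := boolP (clique D).
  by left; exists D.
case=> x [z [p [xD zD xz nxz xp]]]; right.
have [y [q [yD xy nxy E_min pq]]] :=
  min_connected_dominating_exchange D_min xD zD xz nxz xp.
have [m [mD xm my]] := private_nbr_radius2 D_conn xD xp yD xy nxy.
set E := p |: D :\ y in E_min pq.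
have mE : m \in E by rewrite !inE mD (adj_neq my) orbT.
have pm : p != m by apply: contraNneq (private_nbr_notin xp) => ->.
have npm : ~~ adj p m by rewrite (private_nbr_nonadj xp mD) // eq_sym adj_neq.
have [w [t [_ _ _ F_min qt]]] :=
  min_connected_dominating_exchange E_min (setU11 _ _) mE pm npm pq.
have xE : x \in E by rewrite !inE xD xy orbT.
set F := q |: E :\ w in F_min qt; have [F_conn F_dom _] := F_min.
exists q, p, x; split.
  rewrite /induced_P3 (private_nbr_nonadj pq) ?adj_neq ?(private_nbr_adj xp) //.
  by rewrite adj_sym (private_nbr_adj pq) adj_sym (private_nbr_adj xp).
apply: dominatingS F_dom.
apply: subset_pendant_P3 F_conn (setU11 _ _) qt _ _ => v.
  exact: private_nbr_pendant pq.
rewrite (private_nbr_swapK _ pq) => /setD1P[_ vE].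
exact: private_nbr_pendant xp vE.
Qed.

End P5Free.
End Domination.

(** * Colourings *)

Lemma leq_bin2S (n : nat) : n <= 'C(n, 2).+1.
Proof. by case: n => // n; rewrite binS bin1; lia. Qed.

Section Coloring.
Variable G : sgraph.
Implicit Types (A K S T : {set G}) (a b p q r v x y : G) (k l : nat).

Definition set_colorable S k := exists f : G -> nat,
  {in S, forall x, f x < k} /\ {in S &, forall x y, adj x y -> f x != f y}.

Lemma set_colorableS S T k l :
  S \subset T -> k <= l -> set_colorable T k -> set_colorable S l.
Proof.
move=> /subsetP ST kl [f [f_lt f_proper]]; exists f; split=> [x xS|x y xS yS].
  by apply: leq_trans kl; apply: f_lt; apply: ST.
by apply: f_proper; apply: ST.
Qed.

Lemma set_colorableU S T k l :
  set_colorable S k -> set_colorable T l -> set_colorable (S :|: T) (k + l).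
Proof.
move=> [f [f_lt f_proper]] [g [g_lt g_proper]].
exists (fun x => if x \in S then f x else k + g x); split=> [x|x y].
  by rewrite inE; case: ifP => [/f_lt ? _|_ /= /g_lt ?]; lia.
rewrite !inE; case: ifP => xS; case: ifP => yS /= xT yT xy.
- exact: f_proper.
- by have := f_lt x xS; lia.
- by have := f_lt y yS; lia.
- by rewrite eqn_add2l g_proper.
Qed.

Lemma set_colorable_bigcup (I : finType) (P : {set I}) (F : I -> {set G}) k :
  {in P, forall i, set_colorable (F i) k} ->
  set_colorable (\bigcup_(i in P) F i) (#|P| * k).
Proof.
move=> F_col; rewrite -sum_nat_const.
apply: (big_ind2 set_colorable) F_col; last by move=> *; apply: set_colorableU.
by exists (fun=> 0); split=> x; rewrite inE.
Qed.

Definition stable S := {in S &, forall x y, ~~ adj x y}.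

Lemma stable_set_colorable S : stable S -> set_colorable S 1.
Proof.
move=> S_stable; exists (fun=> 0); split=> // x y xS yS.
by rewrite (negPf (S_stable x y xS yS)).
Qed.

Lemma chromatic_number_le k :
  set_colorable [set: G] k -> chromatic_number G <= k.
Proof.
move=> [f [f_lt f_proper]]; rewrite /chromatic_number.
case: ex_minnP => m _; apply.
apply/existsP; exists [ffun x => Ordinal (f_lt x (in_setT x))].
apply/forallP=> x; apply/forallP=> y; apply/implyP=> xy.
by rewrite !ffunE -val_eqE f_proper ?inE.
Qed.

Lemma cliqueS A K : A \subset K -> clique K -> clique A.
Proof.
move=> /subsetP AK /cliqueP K_clique; apply/cliqueP=> x y xA yA.
by apply: K_clique; apply: AK.
Qed.

Lemma cliqueU1 K x : K \subset nbhd x -> clique K -> clique (x |: K).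
Proof.
move=> /subsetP Kx /cliqueP K_clique; apply/cliqueP=> y z.
move=> /setU1P[->|yK] /setU1P[->|zK]; first by rewrite eqxx.
- by have := Kx z zK; rewrite inE.
- by have := Kx y yK; rewrite inE adj_sym.
- exact: K_clique.
Qed.

Definition set_clique_number S :=
  \max_(K : {set G} | clique K && (K \subset S)) #|K|.

Lemma leq_set_clique_number S K :
  clique K -> K \subset S -> #|K| <= set_clique_number S.
Proof. by move=> K_clique KS; apply: leq_bigmax_cond; rewrite K_clique. Qed.

Definition maximum_clique S K :=
  [/\ clique K, K \subset S & #|K| = set_clique_number S].

Lemma ex_maximum_clique S : exists K, maximum_clique S K.
Proof.
have P0 : clique (set0 : {set G}) && (set0 \subset S).
  by rewrite sub0set andbT; apply/cliqueP=> x y; rewrite inE.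
pose P K := clique K && (K \subset S).
case: (@arg_maxnP _ set0 P (fun K => #|K|) P0) => K /andP[K_clique KS] K_max.
exists K; split=> //; apply/eqP.
by rewrite eqn_leq leq_set_clique_number //; apply/bigmax_leqP.
Qed.

Lemma maximum_clique_nonnbr S K x :
  maximum_clique S K -> x \in S -> ~~ (K \subset nbhd x).
Proof.
move=> [K_clique KS K_max] xS; apply/negP=> Kx.
have xK : x \notin K.
  by apply/negP=> /(subsetP Kx); rewrite inE adj_irr.
suff : #|x |: K| <= #|K| by rewrite cardsU1 xK ltnn.
by rewrite K_max leq_set_clique_number ?cliqueU1 // subUset sub1set xS.
Qed.

Lemma maximum_clique_swap S K a y :
  maximum_clique S K -> a \in K -> y \in S -> K :\ a \subset nbhd y ->
  maximum_clique S (y |: K :\ a).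
Proof.
move=> [K_clique KS K_max] aK yS Kay; split.
- exact: cliqueU1 (cliqueS (subD1set _ _) K_clique).
- by rewrite subUset sub1set yS (subset_trans (subD1set _ _)).
have yK : y \notin K :\ a by apply/negP=> /(subsetP Kay); rewrite inE adj_irr.
by rewrite -K_max cardsU1 yK [in RHS](cardsD1 a K) aK.
Qed.

Definition vertex_pairs K := [set B : {set G} | B \subset K & #|B| == 2].

Definition with_unique_nonnbr S K a := [set x in S | K :\: nbhd x == [set a]].

Lemma stable_unique_nonnbr S K a :
  maximum_clique S K -> a \in K -> stable (with_unique_nonnbr S K a).
Proof.
move=> K_max aK x y; rewrite !inE => /andP[xS /eqP Kx] /andP[yS /eqP Ky].
have sub_nbhd z : K :\: nbhd z = [set a] -> K :\ a \subset nbhd z.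
  by move=> <-; rewrite setDDr setDv set0U subsetIr.
have Ka_max := maximum_clique_swap K_max aK yS (sub_nbhd y Ky).
apply: contra (maximum_clique_nonnbr Ka_max xS) => xy.
by rewrite subUset sub1set inE xy sub_nbhd.
Qed.

Lemma stable_common_nonnbrs S a b :
  twoK2_free S -> a \in S -> b \in S -> adj a b ->
  stable (S :\: nbhds [set a; b]).
Proof.
move=> S_free aS bS ab x y /setDP[xS x_far] /setDP[yS y_far].
have far z : z \notin nbhds [set a; b] -> ~~ adj a z /\ ~~ adj b z.
  by move=> z_far; split; apply: contraNN z_far => ?; apply/nbhdsP;
     [exists a | exists b]; rewrite ?inE ?eqxx ?orbT.
have [[nax nbx] [nay nby]] := (far x x_far, far y y_far).
apply: contra (S_free a b x y aS bS xS yS) => xy.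
by rewrite /induced_2K2 ab xy nax nay nbx nby.
Qed.

Lemma maximum_clique_nonnbr_cover S K :
  maximum_clique S K ->
  S \subset \bigcup_(B in vertex_pairs K) (S :\: nbhds B) :|:
            \bigcup_(a in K) with_unique_nonnbr S K a.
Proof.
move=> K_max; apply/subsetP=> x xS.
have : 0 < #|K :\: nbhd x|.
  by rewrite card_gt0 setD_eq0; apply: maximum_clique_nonnbr K_max xS.
rewrite leq_eqVlt eq_sym in_setU.
case/orP=> [/cards1P[a Kx]|/card_gt1P[a [b [/setDP[aK xa] /setDP[bK xb] ab]]]].
  apply/orP; right; apply/bigcupP; exists a; last by rewrite inE xS Kx eqxx.
  by have /setDP[] : a \in K :\: nbhd x by rewrite Kx set11.
apply/orP; left; apply/bigcupP; exists [set a; b].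
  by rewrite inE subUset !sub1set aK bK cards2 ab.
rewrite inE xS andbT; apply/nbhdsP=> -[d /set2P[]-> dx].
- by rewrite inE adj_sym dx in xa.
- by rewrite inE adj_sym dx in xb.
Qed.

(* Wagon's argument: the colour of a vertex is a pair of nonneighbours in a
   maximum clique or, failing that, its only nonneighbour there. *)
Lemma twoK2_free_set_colorable S :
  twoK2_free S -> set_colorable S 'C((set_clique_number S).+1, 2).
Proof.
move=> S_free; have [K K_max] := ex_maximum_clique S.
have [/cliqueP K_adj KS K_card] := K_max.
have pair_col : set_colorable
    (\bigcup_(B in vertex_pairs K) (S :\: nbhds B)) ('C(#|K|, 2) * 1).
  rewrite -cards_draws; apply: set_colorable_bigcup => B; rewrite inE.
  case/andP=> BK /cards2P[a [b [ab B_eq]]]; move: BK; rewrite B_eq.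
  rewrite subUset !sub1set => /andP[aK bK]; apply: stable_set_colorable.
  apply: stable_common_nonnbrs (subsetP KS a aK) (subsetP KS b bK) _ => //.
  exact: K_adj.
have one_col : set_colorable
    (\bigcup_(a in K) with_unique_nonnbr S K a) (#|K| * 1).
  apply: set_colorable_bigcup => a aK.
  exact/stable_set_colorable/stable_unique_nonnbr.
rewrite !muln1 in pair_col one_col; rewrite binS bin1 -K_card.
exact: set_colorableS (maximum_clique_nonnbr_cover K_max) (leqnn _)
  (set_colorableU pair_col one_col).
Qed.

Lemma ltn_set_clique_number_nbhd v :
  set_clique_number (nbhd v) < clique_number G.
Proof.
have [K [K_clique Kv <-]] := ex_maximum_clique (nbhd v).
have vK : v \notin K by apply/negP=> /(subsetP Kv); rewrite inE adj_irr.
have <- : #|v |: K| = #|K|.+1 by rewrite cardsU1 vK.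
by apply: leq_bigmax_cond; apply: cliqueU1.
Qed.

Lemma dominating_clique_cover K a b :
  clique K -> dominating K -> a \in K -> b \in K -> adj a b ->
  [set: G] \subset nbhds [set a; b] :|:
    \bigcup_(v in K :\: [set a; b]) (nbhd v :\: nbhds [set a; b]).
Proof.
move=> /cliqueP K_adj /eqP K_dom aK bK ab; apply/subsetP=> x _.
rewrite in_setU; have [//|x_ab] := boolP (x \in nbhds [set a; b]).
have xK : x \notin K.
  apply: contraNN x_ab => xK; apply/nbhdsP.
  have [->|xa] := eqVneq x a; first by exists b; rewrite ?set22 // adj_sym.
  by exists a; rewrite ?set21 // K_adj // eq_sym.
have : x \in closed_nbhd K by rewrite K_dom.
rewrite inE (negPf xK) => /nbhdsP[d dK dx].
apply/bigcupP; exists d; last by rewrite !inE x_ab.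
by rewrite inE dK andbT; apply: contraNN x_ab => d_ab; apply/nbhdsP; exists d.
Qed.

Section LocallyTwoK2Free.
Hypothesis nbhd_free : forall v, twoK2_free (nbhd v).

Lemma nbhds_set_colorable A :
  set_colorable (nbhds A) (#|A| * 'C(clique_number G, 2)).
Proof.
apply: set_colorable_bigcup => v _ /=.
apply: set_colorableS (twoK2_free_set_colorable (@nbhd_free v)) => //.
by apply: leq_bin2l; apply: ltn_set_clique_number_nbhd.
Qed.

Lemma dominating_P3_set_colorable p q r :
  induced_P3 p q r -> dominating [set p; q; r] ->
  set_colorable [set: G] (3 * 'C(clique_number G, 2)).
Proof.
move=> /and3P[pq qr _] /eqP pqr_dom.
apply: set_colorableS (nbhds_set_colorable [set p; q; r]).
  rewrite -pqr_dom subUset subxx andbT; apply/subsetP=> x x_in; apply/nbhdsP.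
  move: x_in; rewrite !inE -orbA.
  by case/or3P=> /eqP->; [exists q|exists p|exists q];
    rewrite ?inE ?eqxx ?orbT // adj_sym.
rewrite leq_mul2r; apply/orP; right.
by rewrite -setUA cardsU1 cardsU1 cards1; do 2 case: (_ \notin _).
Qed.

Lemma dominating_clique_set_colorable K :
  1 < clique_number G -> clique K -> dominating K ->
  set_colorable [set: G] (3 * 'C(clique_number G, 2)).
Proof.
move=> omega_gt1 K_clique K_dom; set c := 'C(_, 2).
have c_gt0 : 0 < c by rewrite bin_gt0.
have [K_le1|/card_gt1P[a [b [aK bK ab_neq]]]] := leqP #|K| 1.
  have K_stable : stable K.
    by move=> x y xK yK; rewrite (card_le1_eqP K_le1 x y) ?adj_irr.
  have K_col := stable_set_colorable K_stable.
  have := set_colorableU K_col (nbhds_set_colorable K).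
  rewrite -/(closed_nbhd K) (eqP K_dom).
  by apply: set_colorableS; rewrite // -/c; nia.
have abK : [set a; b] \subset K by rewrite subUset !sub1set aK.
have /cliqueP K_adj := K_clique; have ab := K_adj a b aK bK ab_neq.
have others_col : set_colorable
    (\bigcup_(v in K :\: [set a; b]) (nbhd v :\: nbhds [set a; b]))
    (#|K :\: [set a; b]| * 1).
  apply: set_colorable_bigcup => v; rewrite !inE negb_or.
  case/andP=> /andP[va vb] vK; apply: stable_set_colorable.
  by apply: stable_common_nonnbrs (@nbhd_free v) _ _ ab; rewrite inE K_adj.
apply: set_colorableS (dominating_clique_cover K_clique K_dom aK bK ab) _
  (set_colorableU (nbhds_set_colorable [set a; b]) others_col).
have K_omega : #|K| <= clique_number G by apply: leq_bigmax_cond.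
have := leq_bin2S (clique_number G).
by rewrite cards2 ab_neq cardsD (setIidPr abK) cards2 ab_neq -/c; lia.
Qed.

End LocallyTwoK2Free.
End Coloring.

Local Open Scope ring_scope.

Lemma natr_bin2 (F : numFieldType) (n : nat) :
  'C(n, 2)%:R = (n%:R ^+ 2 - n%:R) / 2%:R :> F.
Proof.
have : (2 * 'C(n, 2) + n = n ^ 2)%N.
  by rewrite -mul_bin_diag bin1; case: n => // n; rewrite -mulnSr.
move/(congr1 (fun k => k%:R : F)).
rewrite GRing.natrD GRing.natrM GRing.natrX => <-.
by field.
Qed.

Theorem theorem1p3 (G : sgraph)
    (Gconn : connected G)
    (Gomega : (2 <= clique_number G)%N)
    (GP5 : induced_free G (path_graph 5))
    (GK : induced_free G (join_graph (complete_graph 1)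
                                     (copies_graph 2 (complete_graph 2)))) :
  (chromatic_number G)%:R <=
    3%:R / 2%:R * ((clique_number G)%:R ^+ 2 - (clique_number G)%:R) :> rat.
Proof.
have nbhd_free v : twoK2_free (nbhd v) := nbhd_twoK2_free GK.
have chi_le : (chromatic_number G <= 3 * 'C(clique_number G, 2))%N.
  apply: chromatic_number_le.
  have [[K K_clique K_dom]|[p [q [r [pqr pqr_dom]]]]] :=
    P5_free_dominating_clique_or_P3 GP5 Gconn.
  - exact: (dominating_clique_set_colorable nbhd_free Gomega K_clique K_dom).
  - exact: (dominating_P3_set_colorable nbhd_free pqr pqr_dom).
rewrite -(Num.Theory.ler_nat rat) GRing.natrM natr_bin2 in chi_le.
by rewrite -GRing.mulrA [_^-1 * _]GRing.mulrC.
Qed.
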